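(* Let $h>0$ be fixed, let $\alpha=(a(h),\{u(t):0\le t\le h\})$ be a DDE initial condition, and let $(a_\alpha(t),b_\alpha(t))_{t\ge h}$ be the associated solution of the fluid equations. Define $$C_1=\sup_{h\le s\le 2h}|a_\alpha(s)-h|,\qquad \kappa(w)=\max\left\{\frac34,\ \exp\left(-\frac{h}{3(w+h)}\right)\right\}\ (w\ge 0),\qquad \mu=-\frac{1}{2h}\log\left(\kappa(C_1/2)\right).$$ Then for all $t\ge 4h$, $$|b_\alpha(t+h)-2h|=|a_\alpha(t)-h|\le C_1\,\kappa(C_1/2)^{-3/2}\,e^{-\mu t}.$$
   Context: $h>0$ is a fixed real number. **DDE initial condition.** A pair $\alpha=(a(h),\{u(t):0\le t\le h\})$ with $a(h)>0$ a real number and $u$ an integrable function on $[0,h]$ with $0\le u(t)\le 2$ for all $t\in[0,h]$. **Solution of the fluid equations associated with $\alpha$.** The unique pair of continuous functions $(a_\alpha(t),b_\alpha(t))=(a(t),b(t))$ on $[h,\infty)$ such that for $h\le t\le 2h$ $$b(t)=a(h)+t-h+\int_{t-h}^h u(s)\,ds,\qquad a(t)=P(h,t)^{-1}a(h)+P(h,t)^{-1}\int_h^t P(h,s)\,ds,$$ where $P(x,y)=\exp\left(2\int_x^y b(s)^{-1}ds\right)$, and for all $t>2h$ $$\frac{da}{dt}=1-2\frac{a(t)}{b(t)},\qquad \frac{db}{dt}=1-2\frac{a(t-h)}{b(t-h)}.$$ *)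

(* Defs.v *)
From HB Require Import structures.
From mathcomp Require Import all_boot all_order all_algebra.
From mathcomp Require Import all_classical all_reals all_analysis.
Set Implicit Arguments.
Unset Strict Implicit.
Unset Printing Implicit Defensive.
Import Order.TTheory GRing.Theory Num.Theory.
Import numFieldNormedType.Exports.
Local Open Scope classical_set_scope.
Local Open Scope ring_scope.

(* [dde_u] is a total function; only its values on [0, h] are constrained or
   used.  Integrability is with respect to Lebesgue measure. *)
Record dde_init (R : realType) (h : R) := DDEInit {
  dde_a : R ;
  dde_u : R -> R ;
  dde_a_gt0 : 0 < dde_a ;
  dde_u_integrable :
    (@lebesgue_measure R).-integrable `[0, h] (fun t => (dde_u t)%:E) ;
  dde_u_bounds : forall t : R, 0 <= t <= h -> 0 <= dde_u t <= 2
}.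

(* P(x, y) = exp (2 \int_x^y ds / b(s)), meaningful for x <= y only: the
   integral is over the set [x, y], hence 0 when y < x. *)
Definition fluid_P (R : realType) (b : R -> R) (x y : R) : R :=
  expR (2 * \int[@lebesgue_measure R]_(s in `[x, y]) (b s)^-1).

(* The functions [a] and [b] are total, but only their restrictions to
   [h, +oo) are constrained. *)
Record fluid_solution (R : realType) (h : R) (alpha : dde_init h)
    (a b : R -> R) : Prop := FluidSolution {
  fluid_a_cont : {within `[h, +oo[, continuous a} ;
  fluid_b_cont : {within `[h, +oo[, continuous b} ;
  fluid_b_init : forall t : R, h <= t <= 2 * h ->
    b t = dde_a alpha + t - h
          + \int[@lebesgue_measure R]_(s in `[t - h, h]) dde_u alpha s ;
  fluid_a_init : forall t : R, h <= t <= 2 * h ->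
    a t = (fluid_P b h t)^-1 * dde_a alpha
          + (fluid_P b h t)^-1
            * \int[@lebesgue_measure R]_(s in `[h, t]) fluid_P b h s ;
  fluid_a_deriv : forall t : R, 2 * h < t ->
    is_derive t (1 : R) a (1 - 2 * (a t / b t)) ;
  fluid_b_deriv : forall t : R, 2 * h < t ->
    is_derive t (1 : R) b (1 - 2 * (a (t - h) / b (t - h)))
}.

Definition fluid_C1 (R : realType) (h : R) (a : R -> R) : R :=
  sup [set `|a s - h| | s in `[h, 2 * h]].

Definition fluid_kappa (R : realType) (h w : R) : R :=
  Num.max (3 / 4) (expR (- (h / (3 * (w + h))))).

Definition fluid_mu (R : realType) (h : R) (a : R -> R) : R :=
  - (1 / (2 * h)) * ln (fluid_kappa h (fluid_C1 h a / 2)).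

(* Main.v *)
Require Import Defs.
From mathcomp Require Import all_boot all_order all_algebra.
From mathcomp Require Import all_classical all_reals all_analysis.
From mathcomp Require Import ring lra.
Import Order.TTheory GRing.Theory Num.Theory.
Import numFieldNormedType.Exports.
Set Implicit Arguments.
Unset Strict Implicit.
Unset Printing Implicit Defensive.
Local Open Scope classical_set_scope.
Local Open Scope ring_scope.

(** Write x = a - h.  Since b(t + h) and a(t) have the same derivative and
    b(2h) = a(h) + h, the difference b(t + h) - a(t) is the constant h
    ([fluid_b_shift]).  This is the equality of the theorem, and it eliminates
    b: for t > 2h,

      x'(t) = (x(t - h) - 2 x(t)) / (x(t - h) + 2h),

    so x is pulled towards half of its delayed value, at a rate 2 / b(t) with
    b(t) = x(t - h) + 2h.  The denominator is positive because a stays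
    nonnegative ([fluid_a_ge0]).

    Suppose that |x| <= M on the delay window [s - h, s], with M <= C1.  Then
    the rate is at least 2 / (C1 + 2h) on [s, s + h], and comparison with the
    solution of the extremal linear equation gives
    |x(t)| <= M/2 + (M/2) exp(- 2 (t - s) / (C1 + 2h)) there
    ([fluid_decay_on_step]).  After a full delay the bound is M (1 + q) / 2,
    where q = exp(- h / (w + h)) and w = C1 / 2; it is at most kappa(w) M
    ([half_decay_le_kappa]), and a bound lying between M / 2 and M persists.
    Hence two delays multiply the bound by kappa(w) ([fluid_geometric_decay]).
    The exponential estimate follows by writing kappa^n as exp(n ln kappa)
    with n the number of complete pairs of delays elapsed since time h.

    All differential inequalities are settled by one comparison principle
    ([nonpos_of_nonincreasing_where_pos]). *)

(** * Real analysis *)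

(** If [f] became positive at [t1], it would have increased since the last
    time it was nonpositive, although its derivative has been nonpositive
    from that time on.  Asking for the sign of [df] only where [f] is positive
    is what lets a barrier be compared with a solution: the differential
    inequality is available only while the solution lies above the barrier. *)
Lemma nonpos_of_nonincreasing_where_pos (R : realType) (f df : R -> R) (s e : R) :
  {within `[s, e], continuous f} ->
  (forall t, s < t < e -> is_derive t (1 : R) f (df t)) ->
  (forall t, s < t < e -> 0 < f t -> df t <= 0) ->
  f s <= 0 -> forall t, s <= t <= e -> f t <= 0.
Proof.
move=> fc fd dneg fs0 t1 /andP[st1 t1e].
rewrite leNgt; apply/negP => ft1.
pose A := [set t | s <= t <= t1 /\ f t <= 0].
have As : A s by split => //; rewrite lexx.
have ubA : ubound A t1 by move=> y [/andP[]].
have supA : has_sup A by split; [exists s|exists t1].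
have st0 : s <= sup A by apply: ub_le_sup => //; exists t1.
have t0t1 : sup A <= t1 by apply: ge_sup => //; exists s.
(* the last time at which [f] is nonpositive is attained, by continuity *)
have ft0 : f (sup A) <= 0.
  rewrite leNgt; apply/negP => ft0.
  have t0se : `[s, e]%classic (sup A).
    by rewrite /= in_itv /= st0 (le_trans t0t1).
  have /subspace_continuousP/(_ _ t0se)/cvgrPdist_lt/(_ _ ft0) := fc.
  rewrite near_withinE => /nbhs_ballP[d /= d0 near_t0].
  have [y [/andP[sy yt1] fy] dy] := sup_adherent d0 supA.
  have yle : y <= sup A by apply: ub_le_sup; [exists t1|split => //; apply/andP].
  have yt0 : ball (sup A) d y.
    by rewrite /ball /= ger0_norm ?subr_ge0 // ltrBlDr -ltrBlDl.
  have yse : `[s, e]%classic y by rewrite /= in_itv /= sy (le_trans yt1).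
  have : f (sup A) - f y < f (sup A) by exact: ltr_normlW (near_t0 y yt0 yse).
  by lra.
have lt01 : sup A < t1.
  rewrite lt_neqAle t0t1 andbT; apply/eqP => E.
  by move: ft0; rewrite E leNgt ft1.
have [| |c] := @MVT _ f df (sup A) t1 lt01.
- move=> x; rewrite in_itv /= => /andP[? ?].
  by apply: fd; apply/andP; split; lra.
- by apply: continuous_subspaceW fc; apply: subset_itvScc; rewrite bnd_simp.
rewrite in_itv /= => /andP[c0 c1] E.
have : df c <= 0.
  apply: dneg; first by apply/andP; split; lra.
  rewrite ltNge; apply/negP => fc0.
  suff : c <= sup A by lra.
  by apply: ub_le_sup; [exists t1|split => //; apply/andP; split; lra].
have : 0 < t1 - sup A by lra.
by nra.
Qed.

Lemma is_derive_integral_upper_bound (R : realType) (f : R -> R) (p q x : R) :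
  {within `[p, q], continuous f} -> p < x < q ->
  is_derive x (1 : R) (fun y => \int[@lebesgue_measure R]_(s in `[p, y]) f s) (f x).
Proof.
move=> fc /andP[px xq].
have fi : (@lebesgue_measure R).-integrable `[p, q] (EFin \o f).
  by apply: continuous_compact_integrable => //; exact: segment_compact.
have cx : {for x, continuous f}.
  apply: within_continuous_continuous fc _; last by rewrite in_itv /= px.
  exact: lt_trans xq.
have [dF dE] := continuous_FTC1_closed xq fi px cx.
by split; [exact: dF|rewrite -derive1E dE].
Qed.

Lemma eq_of_zero_derivative (R : realType) (f : R -> R) (p q : R) :
  p <= q -> {within `[p, q], continuous f} ->
  (forall x, p < x < q -> is_derive x (1 : R) f 0) -> f q = f p.
Proof.
move=> pq fc f0.
have df x : x \in `]p, q[ -> is_derive x (1 : R) f (cst 0 x).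
  by rewrite in_itv /= => /f0.
have [c _] := MVT_segment pq df fc.
by rewrite mul0r => /subr0_eq.
Qed.

Lemma is_derive_mull (R : realType) (f : R -> R) (c x df : R) :
  is_derive x (1 : R) f df -> is_derive x (1 : R) (fun y => c * f y) (c * df).
Proof. exact: is_deriveZ. Qed.

(** * The first delay intervals, and the elimination of b *)

Lemma fluid_a_cont_itv (R : realType) (h : R) (alpha : dde_init h)
    (a b : R -> R) (p q : R) :
  fluid_solution alpha a b -> h <= p -> {within `[p, q], continuous a}.
Proof.
move=> sol hp; apply: continuous_subspaceW (fluid_a_cont sol) => y /=.
by rewrite !in_itv /= andbT => /andP[py _]; rewrite (le_trans hp).
Qed.

Lemma fluid_b_gt0_init (R : realType) (h : R) (alpha : dde_init h)
    (a b : R -> R) (t : R) :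
  fluid_solution alpha a b -> h <= t <= 2 * h -> 0 < b t.
Proof.
move=> sol th; rewrite (fluid_b_init sol th); move: th => /andP[ht t2h].
have := dde_a_gt0 alpha.
suff : 0 <= \int[@lebesgue_measure R]_(s in `[t - h, h]) dde_u alpha s by lra.
apply: Rintegral_ge0 => s /=; rewrite in_itv /= => /andP[ths sh].
have s0h : 0 <= s <= h by apply/andP; split; lra.
by have /andP[] := dde_u_bounds alpha s0h.
Qed.

Lemma fluid_a_start (R : realType) (h : R) (alpha : dde_init h)
    (a b : R -> R) :
  0 < h -> fluid_solution alpha a b -> a h = dde_a alpha.
Proof.
move=> h0 sol; rewrite (fluid_a_init sol); last by rewrite lexx /=; lra.
rewrite /fluid_P set_itv1 !Rintegral_set1 mulr0 expR0.
by rewrite invr1 !mul1r addr0.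
Qed.

(** The equation for a' holds on the initial interval as well: there a is
    given by variation of constants, with [fluid_P] the integrating factor of
    a' = 1 - 2 a / b. *)
Lemma fluid_a_deriv_init (R : realType) (h : R) (alpha : dde_init h)
    (a b : R -> R) (t : R) :
  fluid_solution alpha a b -> h < t < 2 * h ->
  is_derive t (1 : R) a (1 - 2 * (a t / b t)).
Proof.
move=> sol ht.
have sub : `[h, 2 * h]%classic `<=` `[h, +oo[%classic by apply: subset_itvl.
have cb : {within `[h, 2 * h], continuous b}.
  exact: continuous_subspaceW sub (fluid_b_cont sol).
have bneq0 s : h <= s <= 2 * h -> b s != 0.
  by move=> hs; rewrite gt_eqF // (fluid_b_gt0_init sol hs).
pose F y := \int[@lebesgue_measure R]_(s in `[h, y]) (b s)^-1.
pose P := fluid_P b h.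
pose Q y := \int[@lebesgue_measure R]_(s in `[h, y]) P s.
have cbV : {within `[h, 2 * h], continuous (fun s => (b s)^-1)}.
  apply/subspace_continuousP => s hs; apply: cvgV.
    by apply: bneq0; move: hs; rewrite /= in_itv.
  by move/subspace_continuousP : cb; exact.
have cF : {within `[h, 2 * h], continuous F}.
  apply: parameterized_integral_continuous; first by move/andP: ht; lra.
  by apply: continuous_compact_integrable => //; exact: segment_compact.
have cP : {within `[h, 2 * h], continuous P}.
  apply/subspace_continuousP => s hs.
  apply: continuous_cvg; first exact: continuous_expR.
  by apply: cvgMr; move/subspace_continuousP : cF; exact.
have dF : is_derive t (1 : R) F (b t)^-1.
  exact: is_derive_integral_upper_bound cbV ht.
have dQ : is_derive t (1 : R) Q (P t).
  exact: is_derive_integral_upper_bound cP ht.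
have P0 s : P s != 0 by rewrite gt_eqF // expR_gt0.
have aE s : h <= s <= 2 * h -> a s = expR (- (2 * F s)) * (dde_a alpha + Q s).
  by move=> hs; rewrite (fluid_a_init sol hs) expRN mulrDr.
have {}dF : is_derive t (1 : R) (fun s => expR (- (2 * F s)))
    (expR (- (2 * F t)) * (- (2 * (b t)^-1))).
  apply: is_derive1_comp.
have {}dQ : is_derive t (1 : R) (fun s => dde_a alpha + Q s) (P t).
  by rewrite -[P t]add0r; apply: is_deriveD.
apply: (near_eq_is_derive (f := fun s => expR (- (2 * F s)) * (dde_a alpha + Q s))).
  have tin : t \in `]h, (2 * h)[ by rewrite in_itv.
  apply: filterS (near_in_itvoo tin) => s; rewrite in_itv /= => /andP[hs s2h].
  by rewrite aE // !ltW.
apply: is_derive_eq (is_deriveM dF dQ) _; rewrite /GRing.scale /=.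
have PE : expR (- (2 * F t)) * P t = 1 by rewrite expRN mulVf //; exact: P0.
rewrite PE aE; last by case/andP: ht => h1 h2; rewrite !ltW.
ring.
Qed.

Lemma fluid_a_deriv_off_2h (R : realType) (h : R) (alpha : dde_init h)
    (a b : R -> R) (t : R) :
  fluid_solution alpha a b -> h < t -> t != 2 * h ->
  is_derive t (1 : R) a (1 - 2 * (a t / b t)).
Proof.
move=> sol ht; rewrite neq_lt => /orP[t2h|t2h].
  by apply: fluid_a_deriv_init sol _; rewrite ht.
exact: fluid_a_deriv sol _ t2h.
Qed.

(** At [2 * h], where the two descriptions of a meet, a' is not given, so the derivative of
    b(s + h) - a(s) is shown to vanish on either side of it and the two pieces
    are joined by continuity. *)
Lemma fluid_b_shift (R : realType) (h : R) (alpha : dde_init h)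
    (a b : R -> R) (t : R) :
  0 < h -> fluid_solution alpha a b -> h <= t -> b (t + h) = a t + h.
Proof.
move=> h0 sol ht.
pose D s := b (s + h) - a s.
have Dc p q : h <= p -> {within `[p, q], continuous D}.
  move=> hp; apply/subspace_continuousP => s /=; rewrite in_itv /= => /andP[ps sq].
  apply: cvgB.
    apply: cvg_within_filter.
    apply: (@cvg_comp _ _ _ (fun x => x + h) b).
      by apply: cvgD; [exact: cvg_id|exact: cvg_cst].
    have /continuous_within_itvcyP[+ _] := fluid_b_cont sol.
    by apply; rewrite in_itv /= andbT; lra.
  have /subspace_continuousP := fluid_a_cont_itv (q := q) sol hp.
  by apply; rewrite /= in_itv /= ps.
have D0 s : h < s -> s != 2 * h -> is_derive s (1 : R) D 0.
  move=> hs s2h; rewrite -(subrr (1 - 2 * (a s / b s))).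
  apply: is_deriveB; last exact: fluid_a_deriv_off_2h sol hs s2h.
  rewrite -[X in is_derive _ _ _ X]mulr1.
  apply: (is_derive1_comp (f := b) (g := fun x => x + h)).
    have := @fluid_b_deriv _ _ _ _ _ sol (s + h).
    by rewrite addrK; apply; lra.
  by rewrite -[X in is_derive _ _ _ X]addr0; apply: is_deriveD.
have Dh : D h = h.
  rewrite /D (fluid_a_start h0 sol) (fluid_b_init sol); last by lra.
  by rewrite (_ : h + h - h = h) ?set_itv1 ?Rintegral_set1; lra.
have Dinit s : h <= s <= 2 * h -> D s = h.
  move=> /andP[hs s2h]; rewrite -Dh; apply: eq_of_zero_derivative hs _ _.
    exact: Dc.
  by move=> x /andP[hx xs]; apply: D0 => //; rewrite lt_eqF //; lra.
suff : D t = h by rewrite /D; lra.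
have [t2h|t2h] := leP t (2 * h); first by rewrite Dinit // ht.
have h2h : h <= 2 * h by lra.
rewrite -(Dinit (2 * h)) ?lexx ?h2h //.
apply: eq_of_zero_derivative (ltW t2h) (Dc _ _ h2h) _.
by move=> x /andP[hx xs]; apply: D0; [lra|rewrite gt_eqF].
Qed.

(** Method of steps: if a >= 0 on one delay interval then b >= h > 0 on the
    next one, and there a' = 1 - 2 a / b is positive wherever a is negative. *)
Lemma fluid_a_ge0 (R : realType) (h : R) (alpha : dde_init h)
    (a b : R -> R) (t : R) :
  0 < h -> fluid_solution alpha a b -> h <= t -> 0 <= a t.
Proof.
move=> h0 sol ht.
have step n : forall s, h <= s <= (n.+2)%:R * h -> 0 <= a s.
  elim: n => [|n IH] s /andP[hs sn].
    rewrite (fluid_a_init sol) ?hs //.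
    rewrite addr_ge0 // mulr_ge0 ?invr_ge0 ?expR_ge0 ?(ltW (dde_a_gt0 _)) //.
    by apply: Rintegral_ge0 => x _; exact: expR_ge0.
  have n2 : 2 <= n.+2%:R :> R by rewrite ler_nat.
  have nS : n.+3%:R = n.+2%:R + 1 :> R by rewrite -natr1.
  rewrite nS in sn.
  have [sn2|sn2] := leP s (n.+2%:R * h); first by rewrite IH // hs.
  rewrite -oppr_le0.
  apply: (@nonpos_of_nonincreasing_where_pos R (fun x => - a x)
    (fun x => - (1 - 2 * (a x / b x))) (n.+2%:R * h) s).
  - apply/subspace_continuousP => x xns; apply: cvgN.
    have hn : h <= n.+2%:R * h by nra.
    by have /subspace_continuousP := fluid_a_cont_itv (q := s) sol hn; apply.
  - move=> x /andP[nx xs]; apply: is_deriveN; apply: fluid_a_deriv sol _ _.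
    by nra.
  - move=> x /andP[nx xs]; rewrite oppr_gt0 oppr_le0 => ax.
    have bx : 0 < b x.
      rewrite -[x](subrK h) (fluid_b_shift h0 sol); last by nra.
      have : 0 <= a (x - h) by apply: IH; apply/andP; split; nra.
      by lra.
    have : a x / b x <= 0 by rewrite pmulr_lle0 ?invr_gt0 // ltW.
    by lra.
  - by rewrite oppr_le0 IH // lexx andbT; nra.
  - by rewrite lexx ltW.
have [n nt] : exists n, t / h < n%:R.
  exists (Num.bound (t / h)).
  by apply: archi_boundP; rewrite divr_ge0 //; lra.
apply: (step n); rewrite ht /=.
move: nt; rewrite ltr_pdivrMr // -!natr1; nra.
Qed.

(** * Decay over one and two delays *)

(** The barrier M/2 + D exp(- g (y - s)) relaxes to M/2 no faster than x does:
    wherever sg * x exceeds it, the derivative of sg * x is at most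
    -(2 / b) (sg * x - M/2), and 2 / b >= g because b <= M + 2h.  Taking
    g = 0 gives a constant bound; g > 0 gives actual decay. *)
Lemma fluid_decay_on_step (R : realType) (h : R) (alpha : dde_init h)
    (a b : R -> R) (s M D g : R) :
  0 < h -> fluid_solution alpha a b -> 2 * h <= s ->
  0 <= D -> 0 <= g -> g * (M + 2 * h) <= 2 ->
  (forall y : R, s - h <= y <= s -> `|a y - h| <= M) ->
  `|a s - h| <= M / 2 + D ->
  forall t : R, s <= t <= s + h ->
  `|a t - h| <= M / 2 + D * expR (- (g * (t - s))).
Proof.
move=> h0 sol s2h D0 g0 gM aM asD t ts.
(* [sg] is a sign, so that both bounds on [a t - h] are obtained at once *)
suff signed (sg : R) :
    `|sg| = 1 -> sg * (a t - h) <= M / 2 + D * expR (- (g * (t - s))).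
  rewrite ler_norml lerNl -mulN1r -[X in _ && (X <= _)]mul1r.
  by rewrite !signed // ?normrN normr1.
move=> sgE.
have le_norm x : sg * x <= `|x|.
  by rewrite (le_trans (ler_norm _)) // normrM sgE mul1r.
pose e y := expR (- (g * (y - s))).
have de x : is_derive x (1 : R) e (- (g * e x)).
  rewrite mulrC -mulrN.
  apply: (is_derive1_comp (f := expR) (g := fun y => - (g * (y - s)))).
  apply: is_deriveN; rewrite -[X in is_derive _ _ _ X]mulr1.
  apply: (@is_derive_mull _ (fun y => y - s)).
  by rewrite -[X in is_derive _ _ _ X]subr0; apply: is_deriveB.
rewrite -subr_le0.
apply: (@nonpos_of_nonincreasing_where_pos R
  (fun y => sg * (a y - h) - (M / 2 + D * e y))
  (fun y => sg * (1 - 2 * (a y / b y)) - D * (- (g * e y))) s (s + h)) => //.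
- apply/subspace_continuousP => y ys.
  have ca : a x @[x --> within `[s, s + h]%classic (nbhs y)] --> a y.
    have hs : h <= s by lra.
    by have /subspace_continuousP := fluid_a_cont_itv (q := s + h) sol hs; apply.
  apply: cvgB; first by apply: cvgMr; apply: cvgB => //; exact: cvg_cst.
  apply: cvgD; first exact: cvg_cst.
  apply: cvgMr; apply: cvg_within_filter.
  have [dey _] := de y.
  by apply: differentiable_continuous; apply/derivable1_diffP.
- move=> y /andP[sy ysh]; apply: is_deriveB.
    apply: (@is_derive_mull _ (fun y => a y - h)).
    rewrite -[X in is_derive _ _ _ X]subr0.
    by apply: is_deriveB; apply: fluid_a_deriv sol _ _; lra.
  by rewrite -[X in is_derive _ _ _ X]add0r; apply: is_deriveD.
- move=> y /andP[sy ysh] fy.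
  have yE : b y = a (y - h) + h.
    by rewrite -{1}[y](subrK h) (fluid_b_shift h0 sol) //; lra.
  have aM' : `|a (y - h) - h| <= M by apply: aM; apply/andP; split; lra.
  have bM : b y <= M + 2 * h by rewrite yE; move: (le_trans (ler_norm _) aM'); lra.
  have b0 : 0 < b y.
    by rewrite yE; have := @fluid_a_ge0 _ _ _ _ _ (y - h) h0 sol; lra.
  have sM : sg * (a (y - h) - h) <= M by apply: le_trans aM'.
  have e0 : 0 < e y := expR_gt0 _.
  have De0 : 0 <= D * e y by rewrite mulr_ge0 // ltW.
  have gb : g * b y <= 2 by apply: le_trans gM; apply: ler_wpM2l.
  have De2 : D * e y * (g * b y) <= D * e y * 2 by apply: ler_wpM2l.
  rewrite -(pmulr_lle0 _ b0).
  have -> : (sg * (1 - 2 * (a y / b y)) - D * - (g * e y)) * b y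
    = sg * (a (y - h) - h) - 2 * (sg * (a y - h)) + D * e y * (g * b y).
    have -> : sg * (a (y - h) - h) = sg * (b y - 2 * h) by rewrite yE; ring.
    by field; rewrite gt_eqF.
  by move: fy; lra.
- by rewrite /e subrr mulr0 oppr0 expR0 mulr1 subr_le0 (le_trans (le_norm _)).
Qed.

Lemma fluid_kappa_bounds (R : realType) (h w : R) :
  0 < h -> 0 <= w -> 3 / 4 <= fluid_kappa h w < 1.
Proof.
move=> h0 w0; rewrite /fluid_kappa le_max lexx /= gt_max.
apply/andP; split; first by lra.
by rewrite expR_lt1 oppr_lt0 divr_gt0 // mulr_gt0 //; lra.
Qed.

(** With r = exp(- h / (3 (w + h))) the claim is (1 + r^3) / 2 <= max (3/4) r.
    If r^3 <= 1/2 the left side is at most 3/4.  Otherwise r^2 and r both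
    exceed 1/2, and 2 r - 1 - r^3 = (1 - r) (r^2 + r - 1) >= 0. *)
Lemma half_decay_le_kappa (R : realType) (h w : R) :
  0 < h -> 0 <= w -> (1 + expR (- (h / (w + h)))) / 2 <= fluid_kappa h w.
Proof.
move=> h0 w0.
pose r := expR (- (h / (3 * (w + h)))).
have wh : 0 < w + h by lra.
have r0 : 0 < r := expR_gt0 _.
have r1 : r < 1 by rewrite expR_lt1 oppr_lt0 divr_gt0 // mulr_gt0.
have -> : expR (- (h / (w + h))) = r ^+ 3.
  by rewrite /r -expRM_natl; congr expR; field; rewrite gt_eqF.
rewrite /fluid_kappa le_max -/r.
have [r3|r3] := leP (r ^+ 3) (1 / 2); apply/orP; [left|right]; first by lra.
have r3r2 : r ^+ 3 <= r ^+ 2 by apply: ler_wiXn2l => //; exact: ltW.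
have r2r : r ^+ 2 <= r by rewrite expr2 ler_piMl // ltW.
have : (1 - r) * (r ^+ 2 + r - 1) >= 0 by apply: mulr_ge0; lra.
have -> : (1 - r) * (r ^+ 2 + r - 1) = 2 * r - 1 - r ^+ 3 by ring.
by lra.
Qed.

(** Let |x| <= M on a period [s - h, s + h] of two delays.  Decay over
    [s, s + h] brings |x| below kappa M at time s + h; since kappa M >= M/2,
    this bound persists over the next two delays, which form the next
    period. *)
Lemma fluid_geometric_decay (R : realType) (h : R) (alpha : dde_init h)
    (a b : R -> R) (C : R) (n : nat) :
  0 < h -> fluid_solution alpha a b ->
  (forall s : R, h <= s <= 2 * h -> `|a s - h| <= C) ->
  forall t : R, h + 2 * h * n%:R <= t <= 3 * h + 2 * h * n%:R ->
  `|a t - h| <= fluid_kappa h (C / 2) ^+ n * C.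
Proof.
move=> h0 sol aC.
have C0 : 0 <= C.
  by apply: le_trans (aC h _); rewrite ?normr_ge0 //; apply/andP; split; lra.
have C2 : 0 <= C / 2 by lra.
have kC : 0 < C / 2 + h by lra.
set k := fluid_kappa h (C / 2).
have /andP[k34 k1] : 3 / 4 <= k < 1 := fluid_kappa_bounds h0 C2.
have k0 : 0 <= k by lra.
(* a bound no smaller than half the bound one delay earlier persists *)
have persist (s M E : R) : 2 * h <= s -> M / 2 <= E ->
    (forall y : R, s - h <= y <= s -> `|a y - h| <= M) -> `|a s - h| <= E ->
    forall t : R, s <= t <= s + h -> `|a t - h| <= E.
  move=> s2h ME aM asE t ts.
  have D0 : 0 <= E - M / 2 by rewrite subr_ge0.
  have gM : 0 * (M + 2 * h) <= 2 by rewrite mul0r.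
  have asD : `|a s - h| <= M / 2 + (E - M / 2) by rewrite (addrC (M / 2)) subrK.
  have := fluid_decay_on_step h0 sol s2h D0 (lexx 0) gM aM asD ts.
  by rewrite mul0r oppr0 expR0 mulr1 (addrC (M / 2)) subrK.
elim: n => [|n IH] t /andP[t1 t2].
  rewrite expr0 mul1r; rewrite mulr0 !addr0 in t1 t2.
  have [t2h|t2h] := leP t (2 * h); first by apply: aC; rewrite t1.
  apply: (persist (2 * h) C) => //; [lra| |apply: aC; lra|lra].
  by move=> y /andP[y1 y2]; apply: aC; apply/andP; split; lra.
pose M := k ^+ n * C.
have M0 : 0 <= M by rewrite mulr_ge0 // exprn_ge0.
have MC : M <= C by rewrite ler_piMl // exprn_ile1 // ltW.
rewrite exprS -mulrA -/M.
have kM : M / 2 <= k * M by nra.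
pose s := 2 * h + 2 * h * n%:R.
have hn0 : 0 <= 2 * h * n%:R by rewrite mulr_ge0 // mulr_ge0 // ltW.
have s2h : 2 * h <= s by rewrite /s; lra.
move: t1 t2; rewrite -natr1 => t1 t2.
have aM (y : R) : s - h <= y <= s + h -> `|a y - h| <= M.
  by rewrite /s => /andP[y1 y2]; apply: IH; apply/andP; split; lra.
have at_end : `|a (s + h) - h| <= k * M.
  (* the relaxation rate is 2 / (C + 2h), allowed since M <= C *)
  have g0 : 0 <= (C / 2 + h)^-1 by rewrite invr_ge0 ltW.
  have gM : (C / 2 + h)^-1 * (M + 2 * h) <= 2 by rewrite ler_pdivrMl //; lra.
  have M20 : 0 <= M / 2 by lra.
  have aMs (y : R) : s - h <= y <= s -> `|a y - h| <= M.
    by move=> /andP[y1 y2]; apply: aM; apply/andP; split; lra.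
  have asM : `|a s - h| <= M / 2 + M / 2.
    by rewrite -splitr; apply: aM; apply/andP; split; lra.
  have := fluid_decay_on_step h0 sol s2h M20 g0 gM aMs asM (t := s + h).
  rewrite lexx lerDl (ltW h0) => /(_ isT)/le_trans; apply.
  rewrite (addrC s) addrK (mulrC _^-1).
  have := ler_wpM2r M0 (half_decay_le_kappa h0 C2); rewrite -/k.
  by lra.
have second (y : R) : s + h <= y <= s + 2 * h -> `|a y - h| <= k * M.
  move=> /andP[y1 y2]; apply: (persist (s + h) M) => //;
    try (apply/andP; split); try lra.
  by move=> z /andP[z1 z2]; apply: aM; apply/andP; split; lra.
have [ts|ts] := leP t (s + 2 * h).
  by apply: second; rewrite ts andbT /s; lra.
apply: (persist (s + 2 * h) (k * M)) => //; try lra.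
- by move=> z /andP[z1 z2]; apply: second; apply/andP; split; lra.
- by apply: second; apply/andP; split; lra.
- by rewrite /s; apply/andP; split; rewrite /s in ts; lra.
Qed.

(** A supremum over an unbounded set would be a default value; continuity of a
    on the compact interval rules this out. *)
Lemma fluid_C1_ge (R : realType) (h : R) (alpha : dde_init h)
    (a b : R -> R) (s : R) :
  0 < h -> fluid_solution alpha a b -> h <= s <= 2 * h ->
  `|a s - h| <= fluid_C1 h a.
Proof.
move=> h0 sol hs.
have ca : {within `[h, 2 * h], continuous (fun x => `|a x - h|)}.
  apply/subspace_continuousP => x xh; apply: cvg_norm; apply: cvgB; last exact: cvg_cst.
  have /subspace_continuousP := fluid_a_cont_itv (q := 2 * h) sol (lexx h).
  exact.
have hh : h <= 2 * h by lra.
have [c _ cmax] := EVT_max hh ca.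
apply: ub_le_sup; last by exists s => //=; rewrite in_itv.
by exists `|a c - h| => _ [y yh <-]; exact: cmax.
Qed.

(** * Exponential convergence *)

Theorem theorem6 (R : realType) (h : R) (h_gt0 : 0 < h) (alpha : dde_init h)
    (a b : R -> R) (sol : fluid_solution alpha a b) (t : R) (ht : 4 * h <= t) :
  `|b (t + h) - 2 * h| = `|a t - h| /\
  `|a t - h| <= fluid_C1 h a * fluid_kappa h (fluid_C1 h a / 2) `^ (- (3 / 2))
                * expR (- fluid_mu h a * t).
Proof.
split.
  rewrite (fluid_b_shift h_gt0 sol); last by lra.
  by congr (`| _ |); ring.
set C := fluid_C1 h a; set k := fluid_kappa h (C / 2).
have aC (s : R) : h <= s <= 2 * h -> `|a s - h| <= C by exact: fluid_C1_ge sol.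
have C0 : 0 <= C.
  by apply: le_trans (aC h _); rewrite ?normr_ge0 //; apply/andP; split; lra.
have C2 : 0 <= C / 2 by lra.
have /andP[k34 k1] : 3 / 4 <= k < 1 := fluid_kappa_bounds h_gt0 C2.
have k0 : 0 < k by lra.
have h2 : 0 < 2 * h by lra.
have q0 : 0 <= (t - h) / (2 * h) by rewrite divr_ge0 //; lra.
(* [t] lies in the period of two delays starting at [h + 2 * h * n] *)
pose n := Num.truncn ((t - h) / (2 * h)).
have /andP[nt tn] := truncn_itv q0.
move: nt tn; rewrite -/n -natr1 ler_pdivlMr // ltr_pdivrMr // => nt tn.
have /le_trans -> // : `|a t - h| <= k ^+ n * C.
  by apply: fluid_geometric_decay sol aC _ _ => //; apply/andP; split; lra.
rewrite mulrC -mulrA; apply: ler_wpM2l => //.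
have -> : k ^+ n = expR (n%:R * ln k) by rewrite expRM_natl lnK.
rewrite /powR gt_eqF // -expRD ler_expR /fluid_mu -/C -/k.
have -> : - (3 / 2) * ln k + - (- (1 / (2 * h)) * ln k) * t
   = (t / (2 * h) - 3 / 2) * ln k by ring.
(* the period ends at time 3h + 2hn, so the exponent t / (2h) - 3/2 is at
   most n *)
rewrite ler_wnM2r //; first by rewrite ln_le0 // ltW.
rewrite lerBlDr ler_pdivrMr //; lra.
Qed.
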